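(* Let $k\geq 2$ be an integer and $\epsilon>0$. Then there exists $C_{\epsilon}$ such that for every integer $C\geq C_{\epsilon}$ there are at least $(1-\epsilon)C^k$ integer $k$-tuples $(a_1,a_2,\dots,a_k)\in [1,C]^k$ for which the equation $$a_1x_1+a_2x_2+\cdots+a_kx_k=a_1x_1'+a_2x_2'+\cdots+a_kx_k'$$ has no non-trivial solutions in the set $\{1,2,\dots,\lfloor C^{1/k-\epsilon}\rfloor\}$. Consequently, for each such $k$-tuple there is a constant $\kappa>0$ (independent of $N$) such that for every positive integer $N$ there exists a set $A\subseteq\{1,2,\dots,N\}$ with $|A|\geq \kappa N^{1/k-\epsilon}$ containing no non-trivial solution to this equation.
   Context: A solution $(x_1,\dots,x_k,x_1',\dots,x_k')$ (all variables taken from the given set) of the equation $a_1x_1+\cdots+a_kx_k=a_1x_1'+\cdots+a_kx_k'$ is called trivial if for every value $\alpha$, the sum of the $a_i$ over the indices $i$ with $x_i=\alpha$ equals the sum of the $a_i$ over the indices $i$ with $x_i'=\alpha$ (equivalently, viewing it as the equation $\sum_i a_ix_i-\sum_i a_ix_i'=0$ in $2k$ variables, for each value the coefficients of the variables taking that value sum to zero). A solution is non-trivial if it is not trivial. *)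

(* Defs.v *)
From mathcomp Require Import all_boot all_order all_algebra.
From mathcomp Require Import finmap.
From mathcomp Require Import all_classical all_reals all_analysis.
Set Implicit Arguments.
Unset Strict Implicit.
Unset Printing Implicit Defensive.
Import Order.TTheory GRing.Theory Num.Theory.
Local Open Scope classical_set_scope.
Local Open Scope ring_scope.

Definition interval1 (n : nat) : set nat := [set m | (1 <= m <= n)%N].

Definition is_solution (k : nat) (a x x' : 'I_k -> nat) : Prop :=
  (\sum_(i < k) a i * x i = \sum_(i < k) a i * x' i)%N.

Definition is_trivial (k : nat) (a x x' : 'I_k -> nat) : Prop :=
  forall alpha : nat,
    (\sum_(i < k | x i == alpha) a i = \sum_(i < k | x' i == alpha) a i)%N.

Definition no_nontrivial_solution (k : nat) (a : 'I_k -> nat) (S : set nat) :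
    Prop :=
  ~ exists x x' : 'I_k -> nat,
      [/\ forall i, S (x i), forall i, S (x' i),
          is_solution a x x' & ~ is_trivial a x x'].

(* The tuples a in [1, C]^k such that the equation with coefficients a has no
   non-trivial solution in {1, ..., floor (C ^ (1/k - eps))}.  A tuple is
   encoded as a finite function into {0, ..., C} with positive values; as
   powR is nonnegative, Num.truncn is the floor. *)
Definition good_tuples (R : realType) (k : nat) (eps : R) (C : nat) :
    {set {ffun 'I_k -> 'I_C.+1}} :=
  [set a : {ffun 'I_k -> 'I_C.+1} |
    [forall i, (1 <= a i)%N] &&
    `[< no_nontrivial_solution (fun i => a i : nat)
          (interval1 (Num.truncn (C%:R `^ (k%:R^-1 - eps)))) >]]%SET.

(* Main.v *)
(* Put M = floor(C^(1/k - eps)). A non-trivial solution in [1, M] gives a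
   nonzero difference vector d in (-M, M)^k with a.d = 0; there are at most
   (2M)^k such d, each killed by at most C^(k-1) tuples a, hence at most
   2^k C^(k - k eps) bad tuples.
   For the dense sets, let a be good and M >= 4; then a.d <> 0 for every nonzero
   d in (-M, M)^k. The product P of all |a.d| is at most (kCM)^((2M)^k).
   If every b <= n + 1 divided some a.d, then P would be a common multiple
   of 1, ..., n + 1, hence at least 2^n, which is false already for some
   n + 1 <= C / const. So some b <= C / const divides no nonzero a.d, and the
   numbers whose base b digits are all less than M have no non-trivial solution,
   as digits can be compared modulo b one position at a time. There are M^m of
   them below b^m, and M >= b^(1/k - eps). *)
Require Import Defs.
From mathcomp Require Import all_boot all_order all_algebra.
From mathcomp Require Import finmap.
From mathcomp Require Import all_classical all_reals all_analysis.
From mathcomp Require Import zify ring lra.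
Import Order.TTheory GRing.Theory Num.Theory.
Local Open Scope nat_scope.

(** * Common multiples of initial intervals and small non-divisors *)

(* Leibniz's harmonic triangle: with [L n j = n.+1 * 'C(n, j)] one has
   [1 / L n.+1 j.+1 = 1 / L n j - 1 / L n.+1 j]. *)
Lemma dvdn_leibniz (N P n j : nat) :
  (forall i, 0 < i <= N -> i %| P) -> j <= n -> n < N ->
  n.+1 * 'C(n, j) %| P.
Proof.
move=> divP; elim: j n => [|j IHj] n.
  by rewrite bin0 muln1 => _ lt_nN; exact: divP.
case: n => // n le_jn lt_nN.
have /dvdnP[p Ep] := IHj n le_jn (ltnW lt_nN).
have /dvdnP[q Eq] := IHj n.+1 (leqW le_jn) lt_nN.
have /= e1 := mul_bin_diag n.+1 j.
have e2 := mul_bin_left n.+1 j.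
have c_gt0 : 0 < 'C(n.+1, j) by rewrite bin_gt0 leqW.
have d_gt0 : 0 < 'C(n, j) by rewrite bin_gt0.
rewrite -(dvdn_addl P (dvdn_mulr q (dvdnn (n.+2 * 'C(n.+1, j.+1))))).
suff -> : P + n.+2 * 'C(n.+1, j.+1) * q = n.+2 * 'C(n.+1, j.+1) * p.
  exact: dvdn_mulr.
have pos : 0 < (n.+1 * 'C(n, j)) * (n.+2 * 'C(n.+1, j)).
  by rewrite !muln_gt0 d_gt0 c_gt0.
apply/eqP; rewrite -(eqn_pmul2r pos); apply/eqP.
have e3 : (n.+1 * 'C(n, j)) * (n.+2 * 'C(n.+1, j)) +
   (n.+2 * 'C(n.+1, j.+1)) * (n.+1 * 'C(n, j)) =
   (n.+2 * 'C(n.+1, j.+1)) * (n.+2 * 'C(n.+1, j)).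
  rewrite e1.
  have -> : n.+2 = j.+1 + (n.+1 - j) by lia.
  move/esym: e2.
  move: (n.+1 - j) 'C(n.+1, j) 'C(n.+1, j.+1) => u c e uc.
  transitivity ((j.+1 + u) * e * (j.+1 * c + j.+1 * e)); first by ring.
  by rewrite -uc; ring.
move: e3 Ep Eq.
move: (n.+1 * 'C(n, j)) (n.+2 * 'C(n.+1, j)) (n.+2 * 'C(n.+1, j.+1)).
move=> A B D e3 Ep Eq.
have -> : (P + D * q) * (A * B) = P * (A * B) + D * A * (q * B) by ring.
rewrite -Eq.
have -> : D * p * (A * B) = (D * B) * (p * A) by ring.
by rewrite -Ep -e3; ring.
Qed.

(** The binomials ['C(n, j)] sum to [2 ^ n], and each of the [n.+1] numbers [n.+1 * 'C(n, j)]
    divides [P], hence is at most [P]. *)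
Lemma leq_exp2_common_multiple (n P : nat) :
  0 < P -> (forall i, 0 < i <= n.+1 -> i %| P) -> 2 ^ n <= P.
Proof.
move=> P_gt0 divP; rewrite -(leq_pmul2l (ltn0Sn n)).
have -> : 2 ^ n = \sum_(j < n.+1) 'C(n, j).
  by rewrite (expnDn 1 1 n); apply: eq_bigr => i _; rewrite !exp1n !muln1.
rewrite big_distrr /= -[X in _ <= X * _]card_ord -sum_nat_const.
apply: leq_sum => j _; apply: dvdn_leq => //.
by apply: (@dvdn_leibniz n.+1) => //; rewrite -ltnS.
Qed.

Lemma exists_common_nondivisor (I : finType) (D : I -> nat) (E n : nat) :
  0 < E -> (forall f, D f <= E) -> E ^ #|I| < 2 ^ n ->
  exists2 b, 0 < b <= n.+1 & forall f, D f != 0 -> ~~ (b %| D f).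
Proof.
move=> E_gt0 leDE ltE; apply: contrapT => nob.
suff : 2 ^ n <= \prod_(f | D f != 0) D f.
  apply/negP; rewrite -ltnNge; apply: leq_ltn_trans ltE.
  (* Zero values become factors 1, which are still at most [E]. *)
  rewrite big_mkcond -prod_nat_const; apply: leq_prod => f _.
  by case: ifP.
apply: leq_exp2_common_multiple => [|b b_le].
  by apply: prodn_cond_gt0 => f; rewrite lt0n.
apply: contrapT => /negP ndiv; apply: nob; exists b => // f Df.
by apply: contra ndiv => /dvdn_trans; apply; rewrite (bigD1 f) //= dvdn_mulr.
Qed.

(** * Difference vectors and the choice of the modulus *)

(* A trivial solution with [x <> x'] yields disjoint, not both empty index sets
   [I], [J] with [\sum_I a = \sum_J a]; then [y = 2, y' = 1] on [I] and
   [y = 3, y' = 4] on [J] is a non-trivial solution. *)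
Lemma solution_eq (k : nat) (a x x' : 'I_k -> nat) (M : nat) :
  4 <= M -> (forall i, 0 < a i) -> no_nontrivial_solution a (interval1 M) ->
  (forall i, 0 < x i <= M) -> (forall i, 0 < x' i <= M) ->
  is_solution a x x' -> x =1 x'.
Proof.
move=> M4 a_gt0 good xM x'M sol.
have triv : is_trivial a x x'.
  by apply: contrapT => nt; apply: good; exists x, x'.
move=> i0; apply/eqP; apply/negPn/negP => neq.
pose u i := x i == x i0; pose u' i := x' i == x i0.
pose y i := if u i then if u' i then 1 else 2 else if u' i then 3 else 1.
pose y' i := if u i then 1 else if u' i then 4 else 1.
apply: good; exists y, y'; split.
- by move=> i; rewrite /interval1 /y /=; case: (u i); case: (u' i); lia.
- by move=> i; rewrite /interval1 /y' /=; case: (u i); case: (u' i); lia.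
- have := triv (x i0); rewrite big_mkcond [RHS]big_mkcond /= => e.
  (* Adding the sum of [a] over [u'] on the left and the equal sum over [u] on the right makes the
     identity hold term by term. *)
  apply/eqP; rewrite -(eqn_add2r (\sum_(i < k) if u' i then a i else 0)).
  rewrite -[in X in _ == X]e -!big_split /=; apply/eqP/eq_bigr => i _.
  by rewrite /y /y' -/(u i); case: (u i); case: (u' i); lia.
(* The value 2 is taken by [y] at [i0] and nowhere by [y']. *)
- move=> /(_ 2); rewrite [RHS]big_pred0; last first.
    by move=> i; rewrite /y'; case: (u i); case: (u' i).
  move/eqP; rewrite sum_nat_eq0 => /forallP/(_ i0)/implyP.
  rewrite /y /u /u' eqxx [x' i0 == _]eq_sym (negbTE neq) => /(_ isT).
  by apply/negP; rewrite -lt0n.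
Qed.

(* A difference vector [d] in [[-M, M)^k] is encoded as [d + M]. *)
Definition shifted_form (k : nat) (a : 'I_k -> nat) (M : nat)
    (f : {ffun 'I_k -> 'I_M.*2}) : int :=
  (\sum_(i < k) (a i)%:Z * ((f i)%:Z - M%:Z))%R.

Lemma exists_difference (k M : nat) (x x' : 'I_k -> nat) :
  (forall i, x i < M) -> (forall i, x' i < M) ->
  exists f : {ffun 'I_k -> 'I_M.*2},
    forall i, ((f i)%:Z - M%:Z = (x i)%:Z - (x' i)%:Z)%R.
Proof.
move=> xM x'M; have fP i : M + x i - x' i < M.*2.
  by have := xM i; have := x'M i; lia.
exists [ffun i => Ordinal (fP i)] => i; rewrite ffunE /=.
by have := xM i; have := x'M i; lia.
Qed.

Lemma shifted_form_difference (k M : nat) (a x x' : 'I_k -> nat)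
    (f : {ffun 'I_k -> 'I_M.*2}) :
  (forall i, (f i)%:Z - M%:Z = (x i)%:Z - (x' i)%:Z)%R ->
  shifted_form k a M f =
  ((\sum_(i < k) a i * x i)%N%:Z - (\sum_(i < k) a i * x' i)%N%:Z)%R.
Proof.
move=> fE; rewrite /shifted_form -!natz !natr_sum -sumrB.
by apply: eq_bigr => i _; rewrite !natz fE !PoszM mulrBr.
Qed.

Lemma shifted_form_le (k M C : nat) (a : 'I_k -> nat) f :
  (forall i, a i <= C) -> `|shifted_form k a M f| <= k * (C * M).
Proof.
move=> aC; rewrite -lez_nat abszE; apply: (le_trans (ler_norm_sum _ _ _)).
have -> : Posz (k * (C * M)) = (\sum_(i < k) (C * M)%N%:Z)%R.
  by rewrite sumr_const card_ord -mulr_natl natz PoszM.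
apply: ler_sum => i _; rewrite normrM PoszM; apply: ler_pM => //.
  by have := aC i; lia.
by have := ltn_ord (f i); lia.
Qed.

(** Stronger than triviality of all solutions: triviality of each digit position separately would
    not combine to triviality of the whole, whereas equality does. *)
Definition injective_form (k : nat) (a : 'I_k -> nat) (A : seq nat) : Prop :=
  forall x x' : 'I_k -> nat, (forall i, x i \in A) -> (forall i, x' i \in A) ->
    is_solution a x x' -> x =1 x'.

Definition injective_form_mod (k : nat) (a : 'I_k -> nat) (b M : nat) : Prop :=
  forall x x' : 'I_k -> nat, (forall i, x i < M) -> (forall i, x' i < M) ->
    \sum_(i < k) a i * x i = \sum_(i < k) a i * x' i %[mod b] -> x =1 x'.

(** If [b] divides no nonzero value of the form at a difference vector, a congruence modulo [b] is
    already an equation. Shifted by one, it is a solution in [interval1 M], where [solution_eq]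
    applies. *)
Lemma exists_modulus (k M C n : nat) (a : 'I_k -> nat) :
  0 < k -> 4 <= M -> (forall i, 0 < a i <= C) ->
  no_nontrivial_solution a (interval1 M) ->
  (k * (C * M)) ^ (M.*2 ^ k) < 2 ^ n ->
  exists2 b, 0 < b <= n.+1 & injective_form_mod k a b M.
Proof.
move=> k_gt0 M4 aC good ltE.
have a_gt0 i : 0 < a i by case/andP: (aC i).
have aleC i : a i <= C by case/andP: (aC i).
have C_gt0 : 0 < C by apply: leq_trans (a_gt0 (Ordinal k_gt0)) _.
have [||b ble bP] := @exists_common_nondivisor _
    (fun f => `|shifted_form k a M f|) (k * (C * M)) n _
    (fun f => @shifted_form_le k M C a f aleC).
- by rewrite !muln_gt0 k_gt0 C_gt0; lia.
- by rewrite card_ffun !card_ord.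
exists b => // x x' xM x'M emod.
have [f fE] := @exists_difference k M x x' xM x'M.
have sE := @shifted_form_difference k M a x x' f fE.
suff sol : is_solution a (fun i => (x i).+1) (fun i => (x' i).+1).
  by move=> i; have [] := solution_eq _ _ (fun i => (x i).+1)
    (fun i => (x' i).+1) _ M4 a_gt0 good xM x'M sol i.
suff : shifted_form k a M f = 0%R.
  rewrite sE => /eqP; rewrite subr_eq0 => /eqP[e].
  rewrite /is_solution; under eq_bigr do rewrite mulnS.
  by rewrite big_split /= e -big_split /=; apply: eq_bigr => i _; rewrite mulnS.
apply/eqP; rewrite -absz_eq0; apply: contraT => /bP/negP[].
have : (b%:Z %| shifted_form k a M f)%Z.
  by rewrite sE -eqz_mod_dvd !modz_nat emod.
by rewrite dvdzE absz_nat.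
Qed.

(** If [b < M], the constant vectors [b] and [0] violate injectivity. Hence numbers below [M] are
    genuine base [b] digits. *)
Lemma injective_form_mod_leq (k : nat) (a : 'I_k -> nat) (b M : nat) :
  0 < k -> 0 < b -> injective_form_mod k a b M -> M <= b.
Proof.
move=> k_gt0 b_gt0 injab; rewrite leqNgt; apply/negP => lt_bM.
have emod : \sum_(i < k) a i * b = \sum_(i < k) a i * 0 %[mod b].
  by rewrite -!big_distrl /= modnMl muln0 mod0n.
have := injab (fun=> b) (fun=> 0) (fun=> lt_bM) (fun=> ltn_trans b_gt0 lt_bM)
  emod (Ordinal k_gt0).
by lia.
Qed.

(** * Sets with restricted digits *)

Fixpoint digit_sums (b M m : nat) : seq nat :=
  if m is m'.+1 then [seq d + b * y | d <- iota 0 M, y <- digit_sums b M m']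
  else [:: 0].

Lemma size_digit_sums (b M m : nat) : size (digit_sums b M m) = M ^ m.
Proof. by elim: m => //= m IH; rewrite size_allpairs size_iota IH expnS. Qed.

Lemma digit_sums_uniq (b M m : nat) :
  0 < b -> M <= b -> uniq (digit_sums b M m).
Proof.
move=> b_gt0 le_Mb; elim: m => //= m IH; apply: allpairs_uniq => //.
  exact: iota_uniq.
move=> _ _ /allpairsP[[d y] [/= dM _ ->]]
  /allpairsP[[d' y'] [/= dM' _ ->]] /= e.
move: dM dM'; rewrite !mem_iota /= add0n => dM dM'.
have edd : d = d'.
  have := congr1 (modn^~ b) e.
  rewrite !(mulnC b) -!(addnC (_ * b)) !modnMDl.
  by rewrite !modn_small // (leq_trans _ le_Mb).
by move: e; rewrite edd => /addnI/eqP; rewrite eqn_pmul2l // => /eqP ->.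
Qed.

Lemma ltn_digit_sums (b M m x : nat) :
  0 < b -> M <= b -> x \in digit_sums b M m -> x < b ^ m.
Proof.
move=> b_gt0 le_Mb; elim: m x => [|m IH] x /=; first by rewrite inE => /eqP ->.
move=> /allpairsP[[d y] [/= dM /IH yb ->]].
move: dM; rewrite mem_iota /= add0n => dM.
apply: (@leq_trans (b * y.+1)); last by rewrite expnS leq_mul2l yb orbT.
by rewrite mulnS ltn_add2r (leq_trans dM).
Qed.

(** Modulo [b] only the lowest digits survive, so they agree; cancelling them and dividing by [b]
    leaves a solution with one digit less. *)
Lemma injective_form_digit_sums (k : nat) (a : 'I_k -> nat) (b M m : nat) :
  0 < b -> injective_form_mod k a b M -> injective_form k a (digit_sums b M m).
Proof.
move=> b_gt0 injab; elim: m => [|m IH] x x' xA x'A sol.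
  by move=> i; have := xA i; have := x'A i; rewrite !inE => /eqP -> /eqP ->.
have digits z : (forall i : 'I_k, z i \in digit_sums b M m.+1) ->
    exists d y : 'I_k -> nat, [/\ forall i, d i < M,
      forall i, y i \in digit_sums b M m & forall i, z i = d i + b * y i].
  move=> zA.
  have /boolp.choice[p pP] : forall i, exists p : nat * nat,
      [/\ p.1 < M, p.2 \in digit_sums b M m & z i = p.1 + b * p.2].
    move=> i; have /= /allpairsP[[d y] [/= dM yA ->]] := zA i.
    by exists (d, y); split=> //; move: dM; rewrite mem_iota.
  by exists (fun i => (p i).1), (fun i => (p i).2); split=> i; case: (pP i).
have [d [y [dM yA xE]]] := digits x xA.
have [d' [y' [d'M y'A x'E]]] := digits x' x'A.
have expand (z u v : 'I_k -> nat) : (forall i, z i = u i + b * v i) ->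
    \sum_(i < k) a i * z i =
    (\sum_(i < k) a i * v i) * b + \sum_(i < k) a i * u i.
  move=> zE; rewrite big_distrl -big_split /=.
  by apply: eq_bigr => i _; rewrite zE; ring.
move: sol; rewrite /is_solution (expand _ _ _ xE) (expand _ _ _ x'E) => sol.
have edd : d =1 d'.
  by apply: injab => //; have := congr1 (modn^~ b) sol; rewrite !modnMDl.
have eyy : y =1 y'.
  apply: IH => //; move: sol.
  have -> : \sum_(i < k) a i * d i = \sum_(i < k) a i * d' i.
    by apply: eq_bigr => i _; rewrite edd.
  by move/addIn/eqP; rewrite eqn_pmul2r // => /eqP.
by move=> i; rewrite xE x'E edd eyy.
Qed.

(** Digit sums include 0, hence the shift by one; it adds the sum of all [a i] to both sides and so
    preserves the equation. *)
Lemma injective_form_no_nontrivial (k : nat) (a : 'I_k -> nat) (A : seq nat) :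
  injective_form k a A ->
  no_nontrivial_solution a [set` [fset x.+1 | x in A]%fset].
Proof.
move=> injaA [x [x' [xA x'A sol []]]].
have pred_in z : z \in [fset x.+1 | x in A]%fset -> 0 < z /\ z.-1 \in A.
  by move=> /imfsetP[u /= uA ->].
suff exx : x =1 x' by move=> c; apply: eq_bigl => i; rewrite exx.
have e : (fun i => (x i).-1) =1 (fun i => (x' i).-1).
  apply: injaA => [i|i|]; first by case: (pred_in _ (xA i)).
    by case: (pred_in _ (x'A i)).
  apply/eqP; rewrite -(eqn_add2r (\sum_(i < k) a i)) -!big_split /=.
  move: sol; rewrite /is_solution => sol.
  under eq_bigr do rewrite -mulnSr prednK ?(pred_in _ (xA _)).1 //.
  rewrite sol; apply/eqP/eq_bigr => i _.
  by rewrite -mulnSr prednK // (pred_in _ (x'A i)).1.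
move=> i; have := e i; have [+ _] := pred_in _ (xA i).
by have [+ _] := pred_in _ (x'A i); lia.
Qed.

Lemma exists_digit_set (k : nat) (a : 'I_k -> nat) (b M m N : nat) :
  0 < k -> 0 < b -> injective_form_mod k a b M -> b ^ m <= N ->
  exists A : {fset nat},
    [/\ [set` A] `<=` interval1 N, #|` A|%fset = M ^ m
      & no_nontrivial_solution a [set` A]]%classic.
Proof.
move=> k_gt0 b_gt0 injab leN.
have le_Mb := injective_form_mod_leq _ _ _ _ k_gt0 b_gt0 injab.
exists [fset x.+1 | x in digit_sums b M m]%fset; split.
- move=> _ /imfsetP[x /= xA ->].
  by rewrite /interval1 /= (leq_trans (ltn_digit_sums _ _ _ _ b_gt0 le_Mb xA)).
- rewrite card_imfset /=; last exact: succn_inj.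
  by rewrite undup_id ?digit_sums_uniq // size_digit_sums.
- exact/injective_form_no_nontrivial/injective_form_digit_sums.
Qed.

(** * Counting bad tuples *)

Lemma card_positive_tuples (k C : nat) :
  C ^ k <= #|[set a : {ffun 'I_k -> 'I_C.+1} | [forall i, 0 < a i]]|.
Proof.
pose up (g : {ffun 'I_k -> 'I_C}) : {ffun 'I_k -> 'I_C.+1} :=
  [ffun j => lift ord0 (g j)].
have up_inj : injective up.
  move=> g h /ffunP e; apply/ffunP => j.
  by have := e j; rewrite !ffunE => /lift_inj.
have -> : C ^ k = #|up @: [set: {ffun 'I_k -> 'I_C}]|.
  by rewrite card_imset // cardsT card_ffun !card_ord.
apply: subset_leq_card; apply/fintype.subsetP => _ /imsetP[g _ ->].
by rewrite inE; apply/forallP => i; rewrite ffunE.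
Qed.

(* Each coordinate [a i0] with [f i0 != M] is determined by the others. *)
Lemma card_shifted_form_eq0 (k C M : nat) (f : {ffun 'I_k -> 'I_M.*2})
    (i0 : 'I_k) :
  f i0 != M :> nat ->
  #|[set a : {ffun 'I_k -> 'I_C.+1} | [forall i, 0 < a i] &&
      (shifted_form k (fun i => a i) M f == 0%R)]| <= C ^ k.-1.
Proof.
case: k f i0 => [f []//|k] f i0 fi0.
case: C => [|C].
  rewrite (eq_card0 _) // => a; rewrite inE.
  apply/negP => /andP[/forallP/(_ i0)].
  by case: (a i0) => -[].
(* Entries lie in [1, C+1]; lowering them by one leaves exactly [C.+1] possible values per
   coordinate. *)
pose restr (a : {ffun 'I_k.+1 -> 'I_C.+2}) : {ffun 'I_k -> 'I_C.+1} :=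
  [ffun j => inord (a (lift i0 j)).-1].
rewrite -(@card_in_imset _ _ restr) => [|a a'].
  by apply: leq_trans (max_card _) _; rewrite card_ffun !card_ord.
rewrite !inE => /andP[/forallP a_gt0 /eqP ea] /andP[/forallP a'_gt0 /eqP ea'].
move=> /ffunP e.
have eq_lift j : a (lift i0 j) = a' (lift i0 j).
  have := congr1 val (e j); rewrite !ffunE /= !inordK; first last.
  - by rewrite -ltnS prednK //; apply: ltn_ord.
  - by rewrite -ltnS prednK //; apply: ltn_ord.
  move/(congr1 succn); rewrite !prednK //; exact: val_inj.
have eq_i0 : a i0 = a' i0.
  have := etrans ea (esym ea').
  rewrite /shifted_form (bigD1 i0) //= [RHS](bigD1 i0) //=.
  have -> : (\sum_(i < k.+1 | i != i0) (a i)%:Z * ((f i)%:Z - M%:Z) =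
             \sum_(i < k.+1 | i != i0) (a' i)%:Z * ((f i)%:Z - M%:Z))%R.
    apply: eq_bigr => i; rewrite eq_sym => /unlift_some[j -> _].
    by rewrite eq_lift.
  move/addIr/mulIf; rewrite subr_eq0 eqz_nat => /(_ fi0)[e0].
  exact: val_inj.
apply/ffunP => i; have [->//|] := eqVneq i i0.
by rewrite eq_sym => /unlift_some[j -> _].
Qed.

Lemma card_bad_tuples (k C M : nat) :
  #|[set a : {ffun 'I_k -> 'I_C.+1} | [forall i, 0 < a i] &&
      ~~ `[< no_nontrivial_solution (fun i => a i : nat) (interval1 M) >]]|
    <= M.*2 ^ k * C ^ k.-1.
Proof.
pose S (f : {ffun 'I_k -> 'I_M.*2}) :=
  [set a : {ffun 'I_k -> 'I_C.+1} | [forall i, 0 < a i] &&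
      (shifted_form k (fun i => a i) M f == 0%R)].
pose nz (f : {ffun 'I_k -> 'I_M.*2}) := [exists i, f i != M :> nat].
apply: (@leq_trans #|\bigcup_(f | nz f) S f|).
  apply: subset_leq_card; apply/fintype.subsetP => a.
  rewrite inE => /andP[a_gt0].
  move=> /negP bad; apply: contrapT => aS; apply: bad; apply/asboolP.
  move=> [x [x' [xM x'M sol nt]]].
  (* Lowering all entries by one brings them into [0, M) and keeps the differences. *)
  have pM i : (x i).-1 < M by move: (xM i); rewrite /interval1 /=; lia.
  have p'M i : (x' i).-1 < M by move: (x'M i); rewrite /interval1 /=; lia.
  have [f fE'] := exists_difference k M _ _ pM p'M.
  have fE i : ((f i)%:Z - M%:Z = (x i)%:Z - (x' i)%:Z)%R.
    rewrite fE'; move: (xM i) (x'M i); rewrite /interval1 /=; lia.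
  apply: nt => c; suff exx : x =1 x' by apply: eq_bigl => i; rewrite exx.
  move=> i; apply: contrapT => neq; apply: aS; apply/bigcupP; exists f.
    apply/existsP; exists i; apply/eqP => fiM.
    by move: (fE i); rewrite fiM; lia.
  rewrite inE a_gt0 (shifted_form_difference _ _ _ _ _ f fE).
  by rewrite subr_eq0; apply/eqP; congr Posz.
have -> : M.*2 ^ k = #|{ffun 'I_k -> 'I_M.*2}| by rewrite card_ffun !card_ord.
apply: (@leq_trans (\sum_(f | nz f) #|S f|)).
  elim/big_ind2: _ => [|A m B n Am Bn|//]; first by rewrite cards0.
  by apply: leq_trans (leq_card_setU _ _) _; apply: leq_add.
rewrite -sum_nat_const big_mkcond; apply: leq_sum => f _.
by case: ifP => // /existsP[i fi]; apply: card_shifted_form_eq0 fi.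
Qed.

Local Open Scope classical_set_scope.
Local Open Scope ring_scope.

(** * Growth estimates for real powers *)

Lemma powR_nat_ge (R : realType) (t K : R) : 0 < t ->
  exists C0 : nat, forall C : nat, (C0 <= C)%N -> K <= C%:R `^ t.
Proof.
move=> t_gt0; pose K' := Num.max K 1.
have K'_ge0 : 0 <= K' by rewrite /K' le_max ler01 orbT.
exists (Num.truncn (K' `^ t^-1)).+1 => C leC.
have h : K' `^ t^-1 <= C%:R.
  have /andP[_ /ltW h] := truncn_itv (powR_ge0 K' t^-1).
  by apply: le_trans h _; rewrite ler_nat.
have := ge0_ler_powR (ltW t_gt0) (powR_ge0 K' t^-1) (ler0n _ _) h.
rewrite -powRrM mulVf ?gt_eqF // powRr1 //; apply: le_trans.
by rewrite /K' le_max lexx.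
Qed.

Lemma ln_lt_powR (R : realType) (t x : R) : 0 < t -> 0 < x ->
  ln x < x `^ t / t.
Proof.
move=> t_gt0 x_gt0; rewrite ltr_pdivlMr // mulrC -ln_powR.
by apply: ln_sublinear; rewrite powR_gt0.
Qed.

(** The exponents (1/k - eps) k and k eps add up to 1. The factor C^(k eps) is the gain that later
    absorbs constants and logarithms. *)
Lemma truncn_powR_expn_le (R : realType) (k C : nat) (eps : R) :
  (0 < k)%N -> (0 < C)%N ->
  (Num.truncn (C%:R `^ (k%:R^-1 - eps) : R))%:R ^+ k * C%:R `^ (k%:R * eps)
    <= C%:R :> R.
Proof.
move=> k_gt0 C_gt0.
have k0 : (k%:R : R) != 0 by rewrite pnatr_eq0 -lt0n.
have C0 : (C%:R : R) != 0 by rewrite pnatr_eq0 -lt0n.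
set y := _ `^ (_ - _).
have leM : (Num.truncn y)%:R <= y.
  by case/andP: (truncn_itv (powR_ge0 _ _ : 0 <= y)).
apply: (@le_trans _ _ (y ^+ k * C%:R `^ (k%:R * eps))).
  by rewrite ler_wpM2r ?powR_ge0 // lerXn2r ?nnegrE ?ler0n ?powR_ge0.
rewrite -powR_mulrn ?powR_ge0 // /y -powRrM -powRD; last by rewrite C0 implybT.
have -> : (k%:R^-1 - eps) * k%:R + k%:R * eps = 1 by field.
by rewrite powRr1.
Qed.

(** Rounding down and removing one multiple of [q] cost less than 2q in total, at most half of
    [C]. *)
Lemma ltn_double_divn (q C : nat) :
  (0 < q)%N -> (4 * q <= C)%N -> (C < 2 * q * (C %/ q).-1)%N.
Proof.
move=> q_gt0; rewrite -leq_divRL // => q_le.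
have := ltn_pmod C q_gt0; rewrite {2}(divn_eq C q).
by move: (C %/ q)%N (C %% q)%N q_le => [|[|[|[|u]]]] v //= _; lia.
Qed.

(** Take n + 1 = floor(C / q) with q^s >= 2. Then (n + 1)^s is at most half of C^s, hence at most
    [M]. For the other bound compare logarithms: 3 ln C (2M)^k against n ln 2, where n > C /
    (2q). *)
Lemma exists_modulus_bound (R : realType) (k : nat) (eps : R) :
  (1 < k)%N -> 0 < eps -> eps < k%:R^-1 ->
  exists C0 : nat, forall C : nat, (C0 <= C)%N ->
    let M := Num.truncn (C%:R `^ (k%:R^-1 - eps) : R) in
    (4 <= M)%N /\ exists n : nat,
      ((k * (C * M)) ^ (M.*2 ^ k) < 2 ^ n)%N /\
      n.+1%:R `^ (k%:R^-1 - eps) <= M%:R :> R.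
Proof.
move=> k_gt1 eps_gt0 lt_eps.
(* With z = C^t, the gain C^(k eps) is z^2: one factor [z] beats the logarithm, the other the
   constants. *)
set s := k%:R^-1 - eps; pose t := k%:R * eps / 2.
have k_gt0 : (0 < k)%N by apply: ltnW.
have kR_gt0 : 0 < (k%:R : R) by rewrite ltr0n.
have s_gt0 : 0 < s by rewrite subr_gt0.
have s_le1 : s <= 1.
  rewrite lerBlDr; apply: (@le_trans _ _ 1); last by rewrite lerDl ltW.
  by rewrite invf_le1 // ler1n.
have t_gt0 : 0 < t by rewrite divr_gt0 // mulr_gt0.
have ln2_gt0 : 0 < ln (2 : R) by rewrite ln_gt0 // ltr1n.
have [q qP] := powR_nat_ge R s 2 s_gt0.
have {qP} : exists q : nat, (0 < q)%N /\ 2 <= (q%:R : R) `^ s.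
  by exists q.+1; split=> //; apply: qP.
move=> {q} [q [q_gt0 q_ge2]].
have qR_gt0 : 0 < (q%:R : R) by rewrite ltr0n.
have [C1 C1P] := powR_nat_ge R s 5 s_gt0.
have [C2 C2P] := powR_nat_ge R t (6 * q%:R * 2 ^+ k / (t * ln 2) + 1) t_gt0.
exists (maxn (maxn C1 C2) (maxn k (4 * q))) => C.
rewrite !geq_max => /andP[/andP[/C1P y5 /C2P zge] /andP[le_kC le_qC]] M.
have C_gt0 : (0 < C)%N by apply: leq_trans le_kC.
have CR_gt0 : 0 < (C%:R : R) by rewrite ltr0n.
set y := _ `^ s in y5; set z := _ `^ t in zge.
have y_ge0 : 0 <= y by apply: powR_ge0.
have /andP[leMy ltyM] := truncn_itv y_ge0; rewrite -/y -/M in leMy ltyM.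
have M4 : (4 <= M)%N.
  by rewrite -ltnS -(ltr_nat R); apply: le_lt_trans ltyM; lra.
split=> //; exists (C %/ q).-1.
have q_le : (4 <= C %/ q)%N by rewrite leq_divRL.
have divE : (C %/ q).-1.+1 = (C %/ q)%N by rewrite prednK // (leq_trans _ q_le).
split; last first.
  rewrite divE; have : ((C %/ q)%:R * q%:R) `^ s <= y.
    apply: ge0_ler_powR; rewrite ?(ltW s_gt0) ?nnegrE -?natrM ?ler0n //.
    by rewrite ler_nat leq_trunc_div.
  rewrite powRM ?ler0n // => h.
  have p_ge0 := powR_ge0 (C %/ q)%:R s.
  move: ltyM; rewrite -natr1 => ltyM.
  have : (C %/ q)%:R `^ s * 2 <= y.
    by apply: le_trans h; rewrite ler_wpM2l.
  have : (4 : R) <= M%:R by rewrite ler_nat.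
  lra.
have M_le : (M <= C)%N.
  rewrite -(ler_nat R); apply: le_trans leMy _.
  by apply: ler1_powR s_le1; rewrite ler1n.
(* Since [k] and [M] are at most [C], the logarithm of the base is at most 3 ln C. *)
have base_le : (k * (C * M) <= C ^ 3)%N.
  by rewrite !expnS expn0 muln1; apply: leq_mul => //; apply: leq_mul.
apply: (@leq_ltn_trans ((C ^ 3) ^ (M.*2 ^ k))).
  by rewrite leq_exp2r // expn_gt0 double_gt0 (leq_trans _ M4).
rewrite -(ltr_nat R) !natrX -ltr_ln ?posrE ?exprn_gt0 //.
rewrite !lnXn ?exprn_gt0 // -(mulr_natr (ln C%:R)).
rewrite -(mulr_natr (ln 2)) -(mulr_natr (_ * 3)) natrX -muln2 natrM exprMn.
have mz : M%:R ^+ k * z ^+ 2 <= C%:R.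
  have := @truncn_powR_expn_le R k C eps k_gt0 C_gt0; rewrite -/s -/y -/M.
  suff -> : C%:R `^ (k%:R * eps) = z ^+ 2 by [].
  by rewrite -powR_mulrn ?powR_ge0 // -powRrM /t; congr powR; field.
have Lt : ln C%:R * t < z by rewrite -ltr_pdivlMr //; apply: ln_lt_powR.
have m_gt0 : 0 < (M%:R : R) ^+ k by rewrite exprn_gt0 // ltr0n (leq_trans _ M4).
have zt : 6 * q%:R * 2 ^+ k < z * (t * ln 2).
  by rewrite -ltr_pdivrMr ?mulr_gt0 //; apply: lt_le_trans zge; rewrite ltrDl.
have nq : C%:R < 2 * q%:R * ((C %/ q).-1)%:R :> R.
  rewrite -!natrM ltr_nat.
  exact: ltn_double_divn.
move: ((C %/ q).-1) nq => n nq.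
have P_gt0 : 0 < (2 : R) ^+ k by rewrite exprn_gt0.
have z_gt0 : 0 < z by apply: powR_gt0.
move: (ln 2) (ln C%:R) (M%:R ^+ k) (2 ^+ k) m_gt0 mz Lt zt P_gt0 ln2_gt0.
move=> l L m P m_gt0 mz Lt zt P_gt0 l_gt0.
(* The factor 2qt clears the denominators in ln C < z / t and n > C / (2q). *)
rewrite -(ltr_pM2l (_ : 0 < 2 * q%:R * t)) ?mulr_gt0 //.
have h1 : 6 * q%:R * P * m * (L * t) < 6 * q%:R * P * m * z.
  by rewrite ltr_pM2l // !mulr_gt0.
have h2 : 6 * q%:R * P * (m * z) < z * (t * l) * (m * z).
  by rewrite ltr_pM2r // mulr_gt0.
have h3 : t * l * (m * z ^+ 2) <= t * l * C%:R.
  by rewrite ler_pM2l // mulr_gt0.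
have h4 : t * l * C%:R < t * l * (2 * q%:R * n%:R).
  by rewrite ltr_pM2l // mulr_gt0.
have -> : 2 * q%:R * t * (L * 3 * (m * P)) = 6 * q%:R * P * m * (L * t) by ring.
have -> : 2 * q%:R * t * (l * n%:R) = t * l * (2 * q%:R * n%:R) by ring.
apply: (lt_trans h1); rewrite -mulrA; apply: (lt_trans h2).
apply: le_lt_trans h4; apply: le_trans h3.
by rewrite le_eqVlt; apply/orP; left; apply/eqP; ring.
Qed.

(** * Density of the good tuples and of the constructed sets *)

(** The bad tuples number at most 2^k C^k / C^(k eps), which is at most eps C^k once C^(k eps) >=
    2^k / eps. *)
Lemma card_good_tuples_ge (R : realType) (k : nat) (eps : R) :
  (0 < k)%N -> 0 < eps ->
  exists C0 : nat, forall C : nat, (C0 <= C)%N ->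
    (1 - eps) * C%:R ^+ k <= (#|good_tuples k eps C|)%:R.
Proof.
move=> k_gt0 eps_gt0.
have t_gt0 : 0 < k%:R * eps by rewrite mulr_gt0 // ltr0n.
have [C1 C1P] := powR_nat_ge R (k%:R * eps) (2 ^+ k / eps) t_gt0.
exists (maxn 1 C1) => C; rewrite geq_max => /andP[C_gt0 /C1P].
have := @truncn_powR_expn_le R k C eps k_gt0 C_gt0.
set M := Num.truncn _; set z := _ `^ (_ * _) => mz zge.
pose bad := [set a : {ffun 'I_k -> 'I_C.+1} | [forall i, (0 < a i)%N] &&
  ~~ `[< no_nontrivial_solution (fun i => a i : nat) (interval1 M) >]]%SET.
have le_pos : (C ^ k <= #|good_tuples k eps C| + #|bad|)%N.
  apply: leq_trans (card_positive_tuples k C) _.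
  apply: leq_trans (leq_card_setU _ _); apply: subset_leq_card.
  apply/fintype.subsetP => a; rewrite !inE => ->.
  exact: orbN.
have le_bad : (#|bad| <= M.*2 ^ k * C ^ k.-1)%N := card_bad_tuples k C M.
suff : (M.*2 ^ k * C ^ k.-1)%N%:R <= eps * C%:R ^+ k.
  move: le_pos le_bad; rewrite -!(ler_nat R) natrD natrX; lra.
rewrite natrM !natrX -muln2 natrM exprMn -[in leRHS](prednK k_gt0) exprS mulrA.
rewrite ler_wpM2r ?exprn_ge0 //.
have zge' : 2 ^+ k <= z * eps by rewrite -ler_pdivrMr.
apply: (@le_trans _ _ (eps * (M%:R ^+ k * z))); last by rewrite ler_pM2l.
rewrite [leRHS](_ : _ = M%:R ^+ k * (z * eps)); last by ring.
by rewrite ler_wpM2l ?exprn_ge0.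
Qed.

(** Choose [m] with b^m <= N < b^(m+1); then M^m >= b^(sm) > b^(-s) N^s. *)
Lemma exists_dense_set (R : realType) (k b M : nat) (a : 'I_k -> nat) (s : R) :
  (0 < k)%N -> (1 < b)%N -> 0 < s -> b%:R `^ s <= M%:R ->
  injective_form_mod k a b M ->
  forall N : nat, (0 < N)%N ->
    exists A : {fset nat},
      [/\ [set` A] `<=` interval1 N,
          (b%:R `^ s)^-1 * N%:R `^ s <= (#|` A|)%fset%:R
        & no_nontrivial_solution a [set` A]].
Proof.
move=> k_gt0 b_gt1 s_gt0 bM injab N N_gt0.
have /andP[leN ltN] := trunc_log_bounds b_gt1 N_gt0.
have bs_gt0 : 0 < (b%:R : R) `^ s by rewrite powR_gt0 // ltr0n ltnW.
have [A [AN cardA goodA]] :=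
  exists_digit_set _ _ _ _ _ _ k_gt0 (ltnW b_gt1) injab leN.
exists A; split=> //; rewrite cardA.
rewrite ler_pdivrMl //; set m := trunc_log b N in ltN *.
apply: (@le_trans _ _ ((b ^ m.+1)%:R `^ s)).
  by apply: ge0_ler_powR; rewrite ?(ltW s_gt0) ?nnegrE ?ler0n // ler_nat ltnW.
rewrite natrX -powR_mulrn // powRAC powR_mulrn ?powR_ge0 // exprS natrX.
by rewrite ler_pM2l // lerXn2r ?nnegrE ?ler0n ?powR_ge0.
Qed.

Lemma no_nontrivial_solution_set1 (k : nat) (a : 'I_k -> nat) (c : nat) :
  no_nontrivial_solution a [set c].
Proof.
move=> [x [x' [xc x'c _ []]]] d; apply: eq_bigl => i.
by rewrite (xc i) (x'c i).
Qed.

Theorem theorem1 (R : realType) (k : nat) (eps : R)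
    (hk : (2 <= k)%N) (heps : 0 < eps) :
  exists C0 : nat, forall C : nat, (C0 <= C)%N ->
    (1 - eps) * C%:R ^+ k <= (#|good_tuples k eps C|)%:R /\
    forall a : {ffun 'I_k -> 'I_C.+1}, a \in good_tuples k eps C ->
      exists kappa : R, 0 < kappa /\
        forall N : nat, (0 < N)%N ->
          exists A : {fset nat},
            [/\ [set` A] `<=` interval1 N,
                kappa * N%:R `^ (k%:R^-1 - eps) <= (#|` A|)%fset%:R
              & no_nontrivial_solution (fun i => a i : nat) [set` A]].
Proof.
have k_gt0 : (0 < k)%N by apply: ltnW.
have [C1 C1P] := card_good_tuples_ge R k eps k_gt0 heps.
(* For eps >= 1/k the exponent is not positive, so N^(1/k - eps) <= 1 and the singleton {1}
   suffices. *)
have [le_eps|lt_eps] := leP k%:R^-1 eps.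
  exists C1 => C /C1P leC; split=> // a _; exists 1; split=> // N N_gt0.
  exists [fset 1%N]%fset; rewrite set_fset1; split.
  - by move=> _ ->; rewrite /interval1 /= N_gt0.
  - rewrite cardfs1 mul1r; apply: (@le_trans _ _ (N%:R `^ 0)).
      by apply: ler_powR; rewrite ?ler1n // subr_le0.
    by rewrite powRr0.
  - exact: no_nontrivial_solution_set1.
have [C2 C2P] := exists_modulus_bound R k eps hk heps lt_eps.
exists (maxn C1 C2) => C; rewrite geq_max => /andP[/C1P leC /C2P].
move=> [M4 [n [ltE leM]]]; split=> // a.
rewrite inE => /andP[/forallP a_gt0 /asboolP good].
have aC i : (0 < a i <= C)%N by rewrite a_gt0 -ltnS ltn_ord.
have [b /andP[b_gt0 leb] injab] :=
  exists_modulus _ _ _ _ _ k_gt0 M4 aC good ltE.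
have le_Mb := injective_form_mod_leq _ _ _ _ k_gt0 b_gt0 injab.
have b_gt1 : (1 < b)%N by apply: leq_trans le_Mb; apply: leq_trans M4.
have s_gt0 : 0 < k%:R^-1 - eps by rewrite subr_gt0.
(* The base [b] was chosen from the tuple alone, so this constant does not depend on [N]. *)
exists (b%:R `^ (k%:R^-1 - eps))^-1; split.
  by rewrite invr_gt0 powR_gt0 // ltr0n.
have leb_M : b%:R `^ (k%:R^-1 - eps) <=
    (Num.truncn (C%:R `^ (k%:R^-1 - eps) : R))%:R :> R.
  apply: le_trans leM.
  by apply: ge0_ler_powR; rewrite ?(ltW s_gt0) ?nnegrE ?ler0n ?ler_nat.
exact: (exists_dense_set R k b _ _ _ k_gt0 b_gt1 s_gt0 leb_M injab).
Qed.
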